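(* Let $E$ and $B$ be finite connected simplicial complexes, let $p\colon E\to B$ be a (Hurewicz simplicial) fibration with fiber $F=p^{-1}(\{b\})$ for a vertex $b$ of $B$, and let $i\colon F\to E$ be the inclusion. Then $$\mathrm{scat}(E)\leq(\mathrm{scat}(i)+1)(\mathrm{scat}(p)+1)-1.$$
   Context: Simplicial complexes are abstract, finite and (edge-path) connected; subcomplexes of a given complex (e.g. members of covers, fibers) are not required to be connected. A simplicial map $f\colon K\to L$ is a map of vertex sets sending simplices to simplices. Simplicial maps $f,g\colon K\to L$ are contiguous, $f\sim_c g$, if $f(\sigma)\cup g(\sigma)$ is a simplex of $L$ for every simplex $\sigma$ of $K$. They are in the same contiguity class, $f\sim g$, if there are simplicial maps $f=f_0\sim_c f_1\sim_c\cdots\sim_c f_m=g$ from $K$ to $L$. The symbol $*$ denotes a map sending every vertex to a single vertex of the codomain; $f\sim *$ means $f\sim c$ for some such constant map $c$. For a simplicial map $f\colon K\to L$, $\mathrm{scat}(f)$ is the least integer $n\ge 0$ such that $K$ is a union of subcomplexes $U_0,\dots,U_n$ with $f|_{U_j}\sim *$ (as maps $U_j\to L$) for all $0\le j\le n$. For a complex $K$, $\mathrm{scat}(K)$ is the least integer $n\ge 0$ such that $K$ is a union of subcomplexes $U_0,\dots,U_n$ with each inclusion $U_j\to K$ satisfying $i_{U_j}\sim *$. A simplicial map $p\colon E\to B$ between connected complexes is a (Hurewicz simplicial) fibration if for every finite simplicial complex $K$, all simplicial maps $f,g\colon K\to B$ with $f\sim g$, and every simplicial map $\widehat f\colon K\to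 E$ with $p\circ\widehat f=f$, there exists a simplicial map $\widehat g\colon K\to E$ with $\widehat f\sim\widehat g$ and $p\circ\widehat g=g$. For a vertex $b$ of $B$, the fiber $F=p^{-1}(\{b\})$ is the subcomplex of $E$ consisting of the simplices all of whose vertices are mapped to $b$. *)

(* Defs.v *)
From HB Require Import structures.
From mathcomp Require Import all_boot.
Set Implicit Arguments.
Unset Strict Implicit.
Unset Printing Implicit Defensive.

(* Finite abstract simplicial complexes, given by their set of (nonempty)
   simplices.  Points of the ambient finite type V need not be vertices, so
   that a complex and its subcomplexes live on the same type; connectedness
   is not part of this structure (see conn_complex). *)
Definition is_complex (V : finType) (K : {set {set V}}) : bool :=
  (set0 \notin K) &&
  [forall s in K, forall t : {set V}, (t != set0) && (t \subset s) ==> (t \in K)].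

Record complex (V : finType) : predArgType := Complex {
  simplices :> {set {set V}};
  complexP : is_complex simplices }.

HB.instance Definition _ (V : finType) := [isSub for @simplices V].
HB.instance Definition _ (V : finType) := [Finite of complex V by <:].

Definition vertices (V : finType) (K : complex V) : {set V} :=
  [set v | [set v] \in simplices K].

Definition edge (V : finType) (K : complex V) : rel V :=
  fun u v => [set u; v] \in simplices K.

Definition edge_path_connected (V : finType) (K : complex V) : bool :=
  (vertices K != set0) &&
  [forall u in vertices K, forall v in vertices K, connect (edge K) u v].

Record conn_complex (V : finType) : predArgType := ConnComplex {
  conn_complex_val :> complex V;
  conn_complexP : edge_path_connected conn_complex_val }.

Definition subcomplex (V : finType) (K : complex V) : predArgType :=
  {U : complex V | simplices U \subset simplices K}.

Coercion subcomplex_val (V : finType) (K : complex V) (U : subcomplex K) :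
  complex V := val U.

(* A map of vertex sets is represented by a function on the ambient type whose
   values off the vertices of K are irrelevant: two representatives of the same
   vertex map are contiguous, and equalities between simplicial maps are stated
   on vertices only. *)
Definition is_simplicial (V W : finType) (K : complex V) (L : complex W)
    (f : {ffun V -> W}) : bool :=
  [forall s in simplices K, f @: s \in simplices L].

Record smap (V W : finType) (K : complex V) (L : complex W) : predArgType :=
  SMap { smap_fun :> {ffun V -> W};
         smapP : is_simplicial K L smap_fun }.

HB.instance Definition _ (V W : finType) (K : complex V) (L : complex W) :=
  [isSub for @smap_fun V W K L].
HB.instance Definition _ (V W : finType) (K : complex V) (L : complex W) :=
  [Finite of smap K L by <:].

Definition contiguous (V W : finType) (K : complex V) (L : complex W) :
    rel (smap K L) :=
  fun f g => [forall s in simplices K, f @: s :|: g @: s \in simplices L].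

Definition same_class (V W : finType) (K : complex V) (L : complex W) :
    rel (smap K L) :=
  connect (@contiguous V W K L).

Lemma smap_res_subproof (V W : finType) (K : complex V) (L : complex W)
  (f : smap K L) (U : subcomplex K) : is_simplicial U L f.
Proof.
apply/forall_inP => s sU; apply: (forall_inP (smapP f)).
exact: (subsetP (valP U)).
Qed.

Definition smap_res (V W : finType) (K : complex V) (L : complex W)
    (f : smap K L) (U : subcomplex K) : smap U L :=
  SMap (smap_res_subproof f U).

Lemma incl_subproof (V : finType) (K : complex V) (U : subcomplex K) :
  is_simplicial U K [ffun x => x].
Proof.
apply/forall_inP => s sU; apply: (subsetP (valP U)).
have -> // : [ffun x => x] @: s = s :> {set V}.
by rewrite -[RHS]imset_id; apply: eq_imset => x; rewrite ffunE.
Qed.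

Definition incl (V : finType) (K : complex V) (U : subcomplex K) : smap U K :=
  SMap (incl_subproof U).

Lemma smap_cst_subproof (V W : finType) (K : complex V) (L : complex W)
  (w : {w : W | w \in vertices L}) :
  is_simplicial K L [ffun=> val w].
Proof.
apply/forall_inP => s sK.
have /set0Pn[v vs] : s != set0.
  by apply: contraTneq sK => ->; case/andP: (complexP K).
have -> : [ffun=> val w] @: s = [set val w].
  apply/setP => y; rewrite inE; apply/imsetP/eqP => [[x _]|->].
    by rewrite ffunE.
  by exists v => //; rewrite ffunE.
by have := valP w; rewrite inE.
Qed.

Definition smap_cst (V W : finType) (K : complex V) (L : complex W)
    (w : {w : W | w \in vertices L}) : smap K L :=
  SMap (smap_cst_subproof K w).

Definition class_trivial (V W : finType) (K : complex V) (L : complex W)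
    (f : smap K L) : bool :=
  [exists w : {w : W | w \in vertices L}, same_class f (smap_cst K w)].

Definition covered (V : finType) (K : complex V) (P : pred (subcomplex K))
    (n : nat) : bool :=
  [exists U : {ffun 'I_n.+1 -> subcomplex K},
     (\bigcup_(j < n.+1) simplices (U j) == simplices K) &&
     [forall j : 'I_n.+1, P (U j)]].

Definition scat_map_pred (V W : finType) (K : complex V) (L : complex W)
    (f : smap K L) : pred nat :=
  covered (fun U : subcomplex K => class_trivial (smap_res f U)).

Definition scat_pred (V : finType) (K : complex V) : pred nat :=
  covered (fun U : subcomplex K => class_trivial (incl U)).

(* Covering by closed simplices shows that both minima exist. *)
Lemma closed_simplex_subproof (V : finType) (s : {set V}) :
  is_complex [set t : {set V} | (t != set0) && (t \subset s)].
Proof.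
apply/andP; split; first by rewrite inE eqxx.
apply/forall_inP => t; rewrite inE => /andP[_ ts].
apply/forallP => u; apply/implyP => /andP[u0 ut].
by rewrite inE u0 (subset_trans ut ts).
Qed.

Definition closed_simplex (V : finType) (s : {set V}) : complex V :=
  Complex (closed_simplex_subproof s).

Lemma closed_simplex_sub (V : finType) (K : complex V) (s : {set V}) :
  s \in set0 |: simplices K ->
  simplices (closed_simplex s) \subset simplices K.
Proof.
rewrite !inE => sK; apply/subsetP => t; rewrite inE => /andP[t0 ts].
case/orP: sK => [/eqP s0|sK]; first by rewrite s0 subset0 (negPf t0) in ts.
have /andP[_ /forall_inP/(_ _ sK)/forallP/(_ t)/implyP] := complexP K.
by apply; rewrite t0.
Qed.

Lemma closed_simplex_trivial (V W : finType) (L : conn_complex W)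
  (s : {set V}) (f : smap (closed_simplex s) L) :
  class_trivial f.
Proof.
have [s0|[v vs]] := set_0Vmem s.
  have /andP[/set0Pn[w wL] _] := conn_complexP L.
  apply/existsP; exists (exist _ w wL); apply: connect1.
  apply/forall_inP => t; rewrite inE => /andP[/set0Pn[x xt] /subsetP ts].
  by move: (in_set0 x); rewrite -[in LHS]s0 (ts x xt).
have fL : f v \in vertices L.
  rewrite inE -imset_set1; apply: (forall_inP (smapP f)).
  by rewrite inE sub1set vs andbT -card_gt0 cards1.
apply/existsP; exists (exist _ (f v) fL); apply: connect1.
apply/forall_inP => t; rewrite inE => /andP[t0 ts].
have -> : smap_cst (closed_simplex s) (exist _ (f v) fL) @: t = f @: [set v].
  rewrite imset_set1; have /set0Pn[x xt] := t0.
  apply/setP => y; rewrite inE; apply/imsetP/eqP => [[z _]|->].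
    by rewrite ffunE.
  by exists x => //; rewrite ffunE.
rewrite -imsetU; apply: (forall_inP (smapP f)).
rewrite inE subUset ts sub1set vs !andbT.
by apply/set0Pn; exists v; rewrite !inE eqxx orbT.
Qed.

Lemma covered_exists (V : finType) (K : complex V) (P : pred (subcomplex K)) :
  (forall (s : {set V})
     (sK : simplices (closed_simplex s) \subset simplices K),
     P (exist _ (closed_simplex s) sK)) ->
  exists n, covered P n.
Proof.
move=> HP; exists #|simplices K|.
pose sig (j : 'I_(#|simplices K|).+1) := nth set0 (enum (simplices K)) j.
have sigK j : sig j \in set0 |: simplices K.
  rewrite !inE; have [jK|jK] := ltnP j (size (enum (simplices K))).
    by rewrite -mem_enum mem_nth ?orbT.
  by rewrite /sig nth_default ?eqxx.
pose U := [ffun j => exist _ (closed_simplex (sig j))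
                           (closed_simplex_sub (sigK j)) : subcomplex K].
apply/existsP; exists U; apply/andP; split; last first.
  by apply/forallP => j; rewrite ffunE; apply: HP.
rewrite eqEsubset; apply/andP; split.
  by apply/bigcupsP => j _; apply: (valP (U j)).
apply/subsetP => s sK.
have ltj : index s (enum (simplices K)) < #|simplices K|.+1.
  by rewrite ltnW // ltnS cardE index_mem mem_enum.
apply/bigcupP; exists (Ordinal ltj) => //; rewrite ffunE inE /=.
rewrite /sig /= nth_index ?mem_enum // subxx andbT.
by apply: contraTneq sK => ->; case/andP: (complexP K).
Qed.

Lemma scat_map_exists (V W : finType) (K : complex V) (L : conn_complex W)
  (f : smap K L) : exists n, scat_map_pred f n.
Proof. by apply: covered_exists => s sK; apply: closed_simplex_trivial. Qed.

Lemma scat_exists (V : finType) (K : conn_complex V) :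
  exists n, scat_pred K n.
Proof. by apply: covered_exists => s sK; apply: closed_simplex_trivial. Qed.

Definition scat_map (V W : finType) (K : complex V) (L : conn_complex W)
    (f : smap K L) : nat :=
  ex_minn (scat_map_exists f).

Definition scat (V : finType) (K : conn_complex V) : nat :=
  ex_minn (scat_exists K).

(* Complexes being connected by convention, the lifting property is only
   required for connected test complexes K. *)
Definition fibration (VE VB : finType) (E : conn_complex VE)
    (B : conn_complex VB) (p : smap E B) : Prop :=
  forall (T : finType) (K : conn_complex T) (f g : smap K B) (fh : smap K E),
    same_class f g ->
    {in vertices K, p \o fh =1 f} ->
    exists gh : smap K E,
      same_class fh gh /\ {in vertices K, p \o gh =1 g}.

Definition fiber_simplices (VE VB : finType) (E : complex VE) (B : complex VB)
    (p : smap E B) (b : VB) : {set {set VE}} :=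
  [set s in simplices E | [forall x in s, p x == b]].

Lemma fiber_subproof (VE VB : finType) (E : complex VE) (B : complex VB)
  (p : smap E B) (b : VB) : is_complex (fiber_simplices p b).
Proof.
have /andP[E0 /forall_inP Edown] := complexP E.
apply/andP; split; first by rewrite inE negb_and E0.
apply/forall_inP => s; rewrite inE => /andP[sE /forall_inP sb].
apply/forallP => t; apply/implyP => tP; rewrite inE.
rewrite (implyP (forallP (Edown _ sE) t) tP); apply/forall_inP => x xt.
by apply: sb; apply: (subsetP _ _ xt); case/andP: tP.
Qed.

Lemma fiber_sub (VE VB : finType) (E : complex VE) (B : complex VB)
  (p : smap E B) (b : VB) :
  simplices (Complex (fiber_subproof p b)) \subset simplices E.
Proof. by apply/subsetP => s; rewrite inE => /andP[]. Qed.

Definition fiber (VE VB : finType) (E : complex VE) (B : complex VB)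
    (p : smap E B) (b : VB) : subcomplex E :=
  exist _ (Complex (fiber_subproof p b)) (fiber_sub p b).

(* Main.v *)
Require Import Defs.
From mathcomp Require Import all_boot.

(** Cover [E] by [m + 1] subcomplexes [U] on which [p] is in the class of a
    constant map, which may be taken to be the constant [b] since [B] is
    connected.  Lifting through the fibration deforms the inclusion of [U] into
    a map [g] with values in the fiber.  Pulling back along [g] a categorical
    cover of the fiber inclusion by [n + 1] subcomplexes cuts [U] into [n + 1]
    pieces, and the inclusion of each piece is in the class of a constant map.
    As the lifting property is only available for connected test complexes
    while [U] may be disconnected, lifting is carried out one connected
    component at a time. *)

Set Implicit Arguments.
Unset Strict Implicit.
Unset Printing Implicit Defensive.

(** * Faces, vertices and edges of a complex *)

Lemma face_in (V : finType) (K : complex V) (s t : {set V}) :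
  s \in simplices K -> t != set0 -> t \subset s -> t \in simplices K.
Proof.
move=> sK t0 ts; have /andP[_ /forall_inP/(_ _ sK)/forallP/(_ t)] := complexP K.
by rewrite t0 ts.
Qed.

Lemma simplex_neq0 (V : finType) (K : complex V) (s : {set V}) :
  s \in simplices K -> s != set0.
Proof. by apply: contraTneq => ->; case/andP: (complexP K). Qed.

Lemma simplex_vertices (V : finType) (K : complex V) (s : {set V}) x :
  s \in simplices K -> x \in s -> x \in vertices K.
Proof.
move=> sK xs; rewrite inE; apply: (face_in sK); last by rewrite sub1set.
by apply/set0Pn; exists x; rewrite inE.
Qed.

Lemma simplex_edge (V : finType) (K : complex V) (s : {set V}) x y :
  s \in simplices K -> x \in s -> y \in s -> edge K x y.
Proof.
move=> sK xs ys; apply: (face_in sK); last by rewrite subUset !sub1set xs.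
by apply/set0Pn; exists x; rewrite !inE eqxx.
Qed.

Lemma edge_sym (V : finType) (K : complex V) : symmetric (edge K).
Proof. by move=> x y; rewrite /edge setUC. Qed.

Lemma edge_connect_sym (V : finType) (K : complex V) : connect_sym (edge K).
Proof. exact/sym_connect_sym/edge_sym. Qed.

(** * Contiguity classes under composition, restriction and change of constant *)

Lemma eq_contiguous (V W : finType) (K : complex V) (L : complex W)
    (f g : smap K L) :
  {in vertices K, f =1 g} -> contiguous f g.
Proof.
move=> fg; apply/forall_inP => s sK.
have <- : f @: s = g @: s.
  by apply: eq_in_imset => x xs; apply/fg/(simplex_vertices sK).
by rewrite setUid (forall_inP (smapP f)).
Qed.

Lemma eq_same_class (V W : finType) (K : complex V) (L : complex W)
    (f g : smap K L) :
  {in vertices K, f =1 g} -> same_class f g.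
Proof. by move=> fg; apply/connect1/eq_contiguous. Qed.

(** A chain of contiguities is carried over link by link, so each operation on maps need only be
    checked on one contiguity. *)
Lemma same_class_homo (V W V' W' : finType) (K : complex V) (L : complex W)
    (K' : complex V') (L' : complex W') (F : smap K L -> smap K' L') :
  {homo F : f g / contiguous f g} -> {homo F : f g / same_class f g}.
Proof.
move=> homoF f g /connectP[q]; elim: q f => [|h q IH] f /=.
  by move=> _ ->; apply: connect0.
case/andP=> fh hq gE; apply: connect_trans (IH h hq gE).
exact/connect1/homoF.
Qed.

Lemma smap_comp_subproof (U V W : finType) (K : complex U) (L : complex V)
    (M : complex W) (g : smap L M) (f : smap K L) :
  is_simplicial K M [ffun x => g (f x)].
Proof.
apply/forall_inP => s sK.
rewrite (eq_imset (g := g \o f)) => [|x]; last by rewrite ffunE.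
by rewrite imset_comp (forall_inP (smapP g)) // (forall_inP (smapP f)).
Qed.

Definition smap_comp (U V W : finType) (K : complex U) (L : complex V)
    (M : complex W) (g : smap L M) (f : smap K L) : smap K M :=
  SMap (smap_comp_subproof g f).

Lemma same_class_compl (U V W : finType) (K : complex U) (L : complex V)
    (M : complex W) (f : smap K L) (g g' : smap L M) :
  same_class g g' -> same_class (smap_comp g f) (smap_comp g' f).
Proof.
apply: (same_class_homo (F := fun g => smap_comp g f)) => {}g {}g' gg'.
apply/forall_inP => s sK.
have compE h : smap_comp h f @: s = h @: (f @: s).
  by rewrite -imset_comp; apply: eq_imset => x; rewrite ffunE.
by rewrite !compE (forall_inP gg') // (forall_inP (smapP f)).
Qed.

Lemma same_class_res (V W : finType) (K : complex V) (L : complex W)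
    (f g : smap K L) (U : subcomplex K) :
  same_class f g -> same_class (smap_res f U) (smap_res g U).
Proof.
apply: (same_class_homo (F := fun f => smap_res f U)) => {}f {}g fg.
apply/forall_inP => s sU.
by apply: (forall_inP fg); apply: (subsetP (valP U)).
Qed.

(** Induction along an edge path of [L] from [v] to [w]: the constants at the two ends of an edge
    have all their values in that edge, hence are contiguous. *)
Lemma same_class_cst (V W : finType) (K : complex V) (L : conn_complex W)
    (v w : {w : W | w \in vertices L}) :
  same_class (smap_cst K v) (smap_cst K w).
Proof.
have : connect (edge L) (val v) (val w).
  have /andP[_ /forall_inP conL] := conn_complexP L.
  exact: (forall_inP (conL _ (valP v)) _ (valP w)).
case/connectP=> q; elim: q v => [|x q IH] v /=.
  by move=> _ wv; apply: eq_same_class => y _; rewrite !ffunE; apply: esym.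
case/andP=> vx xq wE.
have xL : x \in vertices L.
  by apply: (simplex_vertices vx); rewrite !inE eqxx orbT.
apply: connect_trans (IH (exist _ x xL) xq wE); apply: connect1.
apply/forall_inP => s sK; apply: (face_in vx).
  have /set0Pn[y ys] := simplex_neq0 sK.
  by apply/set0Pn; exists (smap_cst K v y); rewrite in_setU imset_f.
by rewrite subUset; apply/andP; split; apply/subsetP => _ /imsetP[y _ ->];
  rewrite ffunE !inE eqxx ?orbT.
Qed.

(** * Connected components and gluing of maps along them *)

Section Component.

Variables (V : finType) (K : complex V) (r : V).

Definition component_simplices : {set {set V}} :=
  [set s in simplices K | s \subset [set x | connect (edge K) r x]].

Lemma component_subproof : is_complex component_simplices.
Proof.
apply/andP; split.
  by rewrite inE negb_and; case/andP: (complexP K) => ->.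
apply/forall_inP => s; rewrite inE => /andP[sK sr].
apply/forallP => t; apply/implyP => /andP[t0 ts].
by rewrite inE (face_in sK) // (subset_trans ts).
Qed.

Lemma component_sub : simplices (Complex component_subproof) \subset simplices K.
Proof. by apply/subsetP => s; rewrite inE => /andP[]. Qed.

Definition component : subcomplex K :=
  exist _ (Complex component_subproof) component_sub.

Lemma component_vertices x :
  (x \in vertices component) = (x \in vertices K) && connect (edge K) r x.
Proof. by rewrite !inE sub1set inE. Qed.

Lemma component_edge x y :
  edge component x y =
  [&& edge K x y, connect (edge K) r x & connect (edge K) r y].
Proof. by rewrite /edge inE subUset !sub1set !inE. Qed.

(** A path of [K] starting at [r] never leaves the component: the points reachable inside the
    component are closed under the edges of [K]. *)
Lemma component_connect x :
  connect (edge K) r x -> connect (edge component) r x.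
Proof.
suff clK : closed (edge K) (connect (edge component) r).
  move=> /(closed_connect clK) rx.
  have : r \in connect (edge component) r by apply: connect0.
  by rewrite rx.
apply: intro_closed; first exact: edge_connect_sym.
move=> y z yz ry; apply: connect_trans (ry) (connect1 _).
have ryK : connect (edge K) r y.
  apply: connect_sub ry => u v; rewrite component_edge => /and3P[uv _ _].
  exact: connect1.
by rewrite component_edge yz ryK (connect_trans ryK (connect1 yz)).
Qed.

Lemma component_connected :
  r \in vertices K -> edge_path_connected component.
Proof.
move=> rK; apply/andP; split.
  by apply/set0Pn; exists r; rewrite component_vertices rK connect0.
apply/forall_inP => x; rewrite component_vertices => /andP[_ rx].
apply/forall_inP => y; rewrite component_vertices => /andP[_ ry].
apply: connect_trans (component_connect ry).
by rewrite edge_connect_sym component_connect.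
Qed.

(** Any two vertices of a simplex span an edge, so no simplex straddles the component and its
    complement. This is what makes gluing simplicial. *)
Lemma simplex_componentP (s : {set V}) : s \in simplices K ->
  (s \in simplices component) \/ {in s, forall x, ~~ connect (edge K) r x}.
Proof.
move=> sK; have [/existsP[x /andP[xs rx]]|] :=
  boolP [exists x in s, connect (edge K) r x].
  left; rewrite inE sK; apply/subsetP => y ys; rewrite inE.
  exact: connect_trans rx (connect1 (simplex_edge sK xs ys)).
by rewrite negb_exists_in => /forall_inP; right.
Qed.

Section Patch.

Variables (W : finType) (L : complex W) (h : smap K L).

Definition patch_fun (u : V -> W) : {ffun V -> W} :=
  [ffun x => if connect (edge K) r x then u x else h x].

Lemma patch_in (u : smap component L) (s : {set V}) :
  s \in simplices component -> patch_fun u @: s = u @: s.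
Proof.
rewrite inE => /andP[_ /subsetP sr]; apply: eq_in_imset => x /sr.
by rewrite inE ffunE => ->.
Qed.

Lemma patch_out (u : smap component L) (s : {set V}) :
  {in s, forall x, ~~ connect (edge K) r x} -> patch_fun u @: s = h @: s.
Proof.
by move=> sr; apply: eq_in_imset => x /sr; rewrite ffunE => /negPf->.
Qed.

Lemma patch_subproof (u : smap component L) : is_simplicial K L (patch_fun u).
Proof.
apply/forall_inP => s sK; case: (simplex_componentP sK) => sr.
  by rewrite patch_in // (forall_inP (smapP u)).
by rewrite patch_out // (forall_inP (smapP h)).
Qed.

Definition patch (u : smap component L) : smap K L := SMap (patch_subproof u).

(** A chain on the component extends to [K] by keeping [h] fixed elsewhere. *)
Lemma patch_same_class (u : smap component L) :
  same_class (smap_res h component) u -> same_class h (patch u).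
Proof.
(* Gluing the restriction of [h] back into [h] changes nothing, so the extended chain does start at
   [h]. *)
have patchK : {in vertices K, h =1 patch (smap_res h component)}.
  by move=> x _; rewrite ffunE; case: ifP.
move=> hu; apply: connect_trans (eq_same_class patchK) _.
apply: same_class_homo hu => v w vw; apply/forall_inP => s sK /=.
case: (simplex_componentP sK) => sr.
  by rewrite !patch_in // (forall_inP vw).
by rewrite !patch_out // setUid (forall_inP (smapP h)).
Qed.

End Patch.
End Component.

(** * Lifting over a possibly disconnected complex *)

Lemma fibration_lift (VE VB T : finType) (E : conn_complex VE)
    (B : conn_complex VB) (p : smap E B) (K : complex T) (f g : smap K B)
    (fh : smap K E) :
  fibration p -> same_class f g -> {in vertices K, p \o fh =1 f} ->
  exists gh : smap K E,
    same_class fh gh /\ {in vertices K, p \o gh =1 g}.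
Proof.
move=> hp fg pfh.
(* Form suited to induction on a list of roots: the map lies over [g] on the components of the
   listed roots and still over [f] on the others. Listing all vertices reaches every component. *)
suff [gh [fgh pgh]] : exists gh : smap K E, same_class fh gh /\
    {in vertices K, forall x, p (gh x) =
      if has (fun r => connect (edge K) r x) (enum (vertices K))
      then g x else f x}.
  exists gh; split=> // x xK /=; rewrite pgh //.
  suff -> : has (fun r => connect (edge K) r x) (enum (vertices K)) by [].
  by apply/hasP; exists x; rewrite ?mem_enum ?connect0.
have : {subset enum (vertices K) <= vertices K} by move=> x; rewrite mem_enum.
elim: (enum _) => [|r s IH] sK.
  by exists fh; split=> [|x /pfh] //; apply: connect0.
have [x xs|gh [fgh pgh]] := IH; first by rewrite sK // inE xs orbT.
have rK : r \in vertices K by rewrite sK ?mem_head.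
(* If an earlier root [t] reaches [r], this component has already been moved and [gh] is kept;
   otherwise [gh] still lies over [f] there, and the fibration applies to the restrictions. *)
have [/hasP[t ts tr]|/hasPn rNs] :=
  boolP (has (fun t => connect (edge K) t r) s).
  exists gh; split=> // x xK; rewrite pgh //=.
  case: (boolP (connect (edge K) r x)) => //= rx.
  suff -> : has (fun r => connect (edge K) r x) s by [].
  by apply/hasP; exists t => //; apply: connect_trans tr rx.
have [] := hp _ (ConnComplex (component_connected rK))
  (smap_res f (component K r)) (smap_res g (component K r))
  (smap_res gh (component K r)).
- exact: same_class_res.
- move=> x; rewrite component_vertices => /andP[xK rx] /=; rewrite pgh //.
  case: hasP => // -[t ts tx]; case/negP: (rNs _ ts).
  by apply: connect_trans tx _; rewrite edge_connect_sym.
move=> u [ghu pu]; exists (patch gh u); split.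
  exact: connect_trans fgh (patch_same_class ghu).
move=> x xK; rewrite ffunE /=; case: ifP => rx /=; last exact: pgh.
by apply: pu; rewrite component_vertices xK.
Qed.

(** * Covers by subcomplexes and their preimages *)

Lemma covered_fin (V I : finType) (K : complex V) (P : pred (subcomplex K))
    (n : nat) (U : I -> subcomplex K) :
  #|I| = n.+1 ->
  (forall s, s \in simplices K -> exists i, s \in simplices (U i)) ->
  (forall i, P (U i)) -> covered P n.
Proof.
(* Enumerating [I] turns the family into one indexed by ordinals; this will serve for covers indexed
   by pairs. *)
move=> In coverU PU; pose idx j : I := enum_val (cast_ord (esym In) j).
apply/existsP; exists [ffun j => U (idx j)]; apply/andP; split; last first.
  by apply/forallP => j; rewrite ffunE.
rewrite eqEsubset; apply/andP; split.
  by apply/bigcupsP => j _; apply: (valP ([ffun j => U (idx j)] j)).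
apply/subsetP => s /coverU[i si]; apply/bigcupP.
exists (cast_ord In (enum_rank i)) => //.
by rewrite ffunE /idx cast_ordK enum_rankK.
Qed.

Lemma coveredP (V : finType) (K : complex V) (P : pred (subcomplex K))
    (n : nat) :
  covered P n -> exists2 U : 'I_n.+1 -> subcomplex K,
    forall s, s \in simplices K -> exists i, s \in simplices (U i) &
    forall i, P (U i).
Proof.
case/existsP=> U /andP[/eqP UK /forallP PU]; exists U => // s.
by rewrite -{1}UK => /bigcupP[i _ si]; exists i.
Qed.

Section Preimage.

Variables (V W : finType) (K : complex V) (U : subcomplex K) (L : complex W).
Variables (g : smap U L) (M : complex W).

Definition preim_simplices : {set {set V}} :=
  [set s in simplices U | g @: s \in simplices M].

Lemma preim_subproof : is_complex preim_simplices.
Proof.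
apply/andP; split.
  by rewrite inE negb_and; case/andP: (complexP U) => ->.
apply/forall_inP => s; rewrite inE => /andP[sU gsM].
apply/forallP => t; apply/implyP => /andP[t0 ts].
by rewrite inE (face_in sU) // (face_in gsM) ?imsetS // imset_eq0.
Qed.

Lemma preim_sub : simplices (Complex preim_subproof) \subset simplices K.
Proof.
apply: subset_trans (valP U).
by apply/subsetP => s; rewrite inE => /andP[].
Qed.

Definition preim : subcomplex K := exist _ (Complex preim_subproof) preim_sub.

Lemma preim_incl_subproof : is_simplicial preim U [ffun x => x].
Proof.
apply/forall_inP => s; rewrite inE => /andP[sU _].
by rewrite (eq_imset (g := id)) ?imset_id // => x; rewrite ffunE.
Qed.

Definition preim_incl : smap preim U := SMap preim_incl_subproof.

Lemma preim_map_subproof : is_simplicial preim M g.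
Proof. by apply/forall_inP => s; rewrite inE => /andP[]. Qed.

Definition preim_map : smap preim M := SMap preim_map_subproof.

End Preimage.

(** On the preimage of [M], the inclusion is in the class of [g], which there factors through [M];
    the chain contracting [M] in [K], precomposed with [g], ends at a constant. *)
Lemma preim_trivial (V : finType) (K : complex V) (U F : subcomplex K)
    (g : smap U K) (M : subcomplex F) :
  same_class (incl U) g -> class_trivial (smap_res (incl F) M) ->
  class_trivial (incl (preim g M)).
Proof.
move=> Ug /existsP[w Mw]; apply/existsP; exists w.
have step1 : same_class (incl (preim g M))
    (smap_comp (incl U) (preim_incl g M)).
  by apply: eq_same_class => x _; rewrite !ffunE.
have step2 : same_class (smap_comp g (preim_incl g M))
    (smap_comp (smap_res (incl F) M) (preim_map g M)).
  by apply: eq_same_class => x _; rewrite !ffunE.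
have step3 : same_class (smap_comp (smap_cst M w) (preim_map g M))
    (smap_cst (preim g M) w).
  by apply: eq_same_class => x _; rewrite !ffunE.
apply: connect_trans step1 _.
apply: connect_trans (same_class_compl _ Ug) _.
apply: connect_trans step2 _.
exact: connect_trans (same_class_compl _ Mw) step3.
Qed.

(** * Deformation into the fiber and the product cover *)

Lemma lift_to_fiber (VE VB : finType) (E : conn_complex VE)
    (B : conn_complex VB) (p : smap E B) (b : VB) (U : subcomplex E) :
  fibration p -> b \in vertices B -> class_trivial (smap_res p U) ->
  exists2 g : smap U E, same_class (incl U) g &
    {in vertices U, forall x, p (g x) = b}.
Proof.
move=> hp hb /existsP[w pw].
(* The constant [w] given by triviality is moved to [b], so that the end of the lift lies over
   [b]. *)
have pb := connect_trans pw (same_class_cst U w (exist _ b hb)).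
have [x xU|g [Ug pg]] := fibration_lift (fh := incl U) hp pb.
  by rewrite /= ffunE.
by exists g => // x /pg /=; rewrite ffunE.
Qed.

Theorem theorem26 (VE VB : finType) (E : conn_complex VE) (B : conn_complex VB)
  (p : smap E B) (hp : fibration p) (b : VB) (hb : b \in vertices B) :
  scat E <= (scat_map (incl (fiber p b)) + 1) * (scat_map p + 1) - 1.
Proof.
rewrite /scat /scat_map.
case: ex_minnP => scE _ minE; case: ex_minnP => n /coveredP[M coverM trivM] _.
case: ex_minnP => m /coveredP[U coverU trivU] _; apply: minE.
(* The lifts are needed as a function of [j]. Both conditions are boolean and [smap] is a finite
   type, so a witness can be extracted from the mere existence. *)
have lift j : {g : smap (U j) E | same_class (incl (U j)) g &
    [forall x in vertices (U j), p (g x) == b]}.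
  apply: sig2_eqW => /=; have [g Ug gb] := lift_to_fiber hp hb (trivU j).
  by exists g => //; apply/forall_inP => x /gb->.
pose g j := s2val (lift j).
apply: (@covered_fin _ ('I_n.+1 * 'I_m.+1)%type _ _ _
         (fun ij => preim (g ij.2) (M ij.1))).
- by rewrite card_prod !card_ord !addn1 subn1 prednK.
- move=> s /coverU[j sj].
  (* All vertices of [s] are sent over [b], so the image of [s] is a simplex of the fiber and lies
     in some [M i]. *)
  have [|i gsi] := coverM (g j @: s).
    rewrite inE (forall_inP (smapP (g j))) //=.
    apply/forall_inP => _ /imsetP[x xs ->].
    exact: (forall_inP (s2valP' (lift j)) _ (simplex_vertices sj xs)).
  by exists (i, j); rewrite inE sj.
- by move=> ij; apply: preim_trivial (s2valP (lift ij.2)) (trivM ij.1).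
Qed.
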